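(* Let $G$ be a cubic graph and let $\tilde G$ be a heavy superposition of $G$. Then $\pi(\tilde G)\ge 5$, i.e. the edges of $\tilde G$ cannot be covered by four perfect matchings.
   Context: $\pi(H)$ denotes the perfect matching index of a cubic graph $H$: the smallest number of perfect matchings whose union is $E(H)$. Graphs may have parallel edges. A multipole is like a graph but may have dangling edges (one end attached to a vertex, the other free); all multipoles are cubic. A $(2,2)$-pole has four dangling edges split into an input connector and an output connector of two edges each. $PG(3,2)$: points are the nonzero vectors of $\mathbb{F}_2^4$, lines the triples $\{x,y,z\}$ with $x+y+z=0$. A tetrahedron $T$ in $PG(3,2)$ is given by four points $p_1,\dots,p_4$ forming a basis of $\mathbb{F}_2^4$ (corner points, of weight $1$); its remaining points are the six sums $c_1+c_2$ of distinct corner points (midpoints, of weight $2$); its lines are the six triples $\{c_1,c_2,c_1+c_2\}$. A $T$-flow (tetrahedral flow) on a cubic graph or multipole is a map $\phi$ from its edges (including dangling ones) to the points of a fixed tetrahedron $T$ such that at each vertex the values on the three incident edges form a line of $T$. A $(2,2)$-pole is heavy if for every tetrahedral flow on it at least two of its four dangling edges receive a value of weight $2$. Heavy superposition: given a cubic graph $G$, replace each vertex $v$ of $G$ by two independent vertices $v_1,v_2$ (lifts, distinct vertices for distinct $v$); replace each edge $e=uv$ of $G$ by a heavy $(2,2)$-pole $X_e$ (pairwise disjoint for distinct edges), attaching the two dangling edges of the input connector of $X_e$ to $u_1$ and $u_2$ respectively and the two dangling edges of the output connector to $v_1$ and $v_2$ respectively. The resulting cubic graph $\tilde G$ is a heavy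 superposition of $G$. *)

(* Defs.v *)
From mathcomp Require Import all_boot all_order all_algebra.
From mathcomp Require Import boolp.

Set Implicit Arguments.
Unset Strict Implicit.
Unset Printing Implicit Defensive.

Import GRing.Theory.

(** Each edge [e] has two ends [(e, false)] and [(e, true)], each of them either
    attached to a vertex or free.  The free ends are named by the elements of
    [L], every name being used exactly once, so the dangling edges correspond
    bijectively to [L].  Parallel edges are allowed; a loop is an edge whose two
    ends are attached to the same vertex. *)
Record multipole (L : finType) := Multipole {
  vertex : finType;
  edge : finType;
  endpoint : edge * bool -> vertex + L;
  free_end_uniq : forall l, #|[set h | endpoint h == inr l]| == 1;
  attachedP : forall e, exists b v, endpoint (e, b) = inl v
}.

Definition graph := multipole void.

(** The name [(s, i)] is the [i]-th edge of the input ([s = false]) or of the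
    output ([s = true]) connector. *)
Definition pole22 := multipole (bool * 'I_2)%type.

Section Multipole.
Variables (L : finType) (M : multipole L).

(** Working with edge ends rather than edges makes a loop count twice. *)
Definition ends_at (v : vertex M) : {set edge M * bool} :=
  [set h | endpoint h == inl v].

Definition cubic : Prop := forall v, #|ends_at v| = 3.

Definition dangling (e : edge M) : bool :=
  [exists b, exists l, endpoint (e, b) == inr l].

End Multipole.

Definition perfect_matching (H : graph) (A : {set edge H}) : bool :=
  [forall v, #|[set h in ends_at v | h.1 \in A]| == 1].

Definition pm_coverable (H : graph) (k : nat) : bool :=
  [exists t : k.-tuple {set edge H},
    all (@perfect_matching H) t && (\bigcup_(A <- t) A == [set: edge H])].

(** [None] stands for infinity: no set of perfect matchings covers [H]. *)
Definition pm_index (H : graph) : option nat :=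
  if pselect (exists k, pm_coverable H k) is left ex_k
  then Some (ex_minn ex_k) else None.

Definition geq_oo (x : option nat) (n : nat) : bool :=
  if x is Some k then n <= k else true.

Local Notation F24 := 'rV['F_2]_4.

Record tetrahedron := Tetrahedron {
  corners :> 4.-tuple F24;
  cornersP : basis_of fullv corners
}.

Section Tetrahedron.
Variable T : tetrahedron.

Definition midpoints : {set F24} :=
  [set (c1 + c2)%R | c1 in corners T, c2 in corners T & c1 != c2].

Definition tpoints : {set F24} := [set x in corners T] :|: midpoints.

Definition tlines : {set {set F24}} :=
  [set [set c1; c2; (c1 + c2)%R] | c1 in corners T, c2 in corners T & c1 != c2].

(** Meaningful on [tpoints] only. *)
Definition weight (x : F24) : nat :=
  if x \in corners T then 1 else if x \in midpoints then 2 else 0.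

(** In a cubic multipole each vertex has three edge ends, and a line has three
    points, so the values on these ends are the points of a line, each once. *)
Definition tetrahedral_flow (L : finType) (M : multipole L)
    (phi : edge M -> F24) : Prop :=
  (forall e, phi e \in tpoints) /\
  (forall v : vertex M, [set phi h.1 | h in ends_at v] \in tlines).

End Tetrahedron.

Definition heavy (X : pole22) : Prop :=
  forall (T : tetrahedron) (phi : edge X -> F24), tetrahedral_flow T phi ->
    2 <= #|[set e | dangling e & weight T (phi e) == 2]|.

Section Superposition.
Variables (G : graph) (X : edge G -> pole22).

(** [inl (v, i)] is the [i]-th lift of [v]. *)
Definition sup_vertex : finType :=
  ((vertex G * 'I_2) + {e : edge G & vertex (X e)})%type.

Definition sup_edge : finType := {e : edge G & edge (X e)}.

(** The end [(e, false)] of [e] plays the role of [u] in [e = uv], and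
    [(e, true)] that of [v]; the opposite choice amounts to exchanging the two
    connectors of [X e].  The last branch is void. *)
Definition sup_endpoint (h : sup_edge * bool) : sup_vertex + void :=
  let e := tag h.1 in
  match endpoint (tagged h.1, h.2) with
  | inl x => inl (inr (Tagged (fun e => vertex (X e)) x))
  | inr (s, i) =>
      match endpoint (e, s) with
      | inl v => inl (inl (v, i))
      | inr l => inr l
      end
  end.

Fact sup_free_end_uniq (l : void) : #|[set h | sup_endpoint h == inr l]| == 1.
Proof. by case: l. Qed.

Fact sup_attachedP (d : sup_edge) :
  exists b x, sup_endpoint (d, b) = inl x.
Proof. by exists true; case: (sup_endpoint _) => [x|[]]; exists x. Qed.

Definition superposition : graph :=
  Multipole sup_free_end_uniq sup_attachedP.

End Superposition.

(* Main.v *)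
Require Import Defs.
From mathcomp Require Import all_boot all_order all_algebra.
From mathcomp Require Import boolp zify.

Set Implicit Arguments.
Unset Strict Implicit.
Unset Printing Implicit Defensive.

Import GRing.Theory.

(** Four perfect matchings that cover a cubic graph give a tetrahedral flow, and
    a tetrahedral flow takes a value of weight 2 on exactly one of the three
    edge ends at each vertex.  If [G] has [n] vertices, the [2 n] lifts thus see
    [2 n] ends of weight 2 in the superposition, whereas its [3 n / 2] heavy
    poles need at least [2 * (3 n / 2) = 3 n] of them. *)

(** A flow can only be built inside some tetrahedron; any basis of the space provides one. *)
Lemma tetrahedron_inhabited : inhabited tetrahedron.
Proof.
have d4 : \dim (@fullv _ 'rV['F_2]_4) = 4 by rewrite dimvf /dim /= mul1n.
have basisT : basis_of fullv (tcast d4 (vbasis (@fullv _ 'rV['F_2]_4))).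
  by rewrite val_tcast vbasisP.
exact: inhabits (Tetrahedron basisT).
Qed.

(** * Points of weight 2 on the lines of a tetrahedron *)

Section Tetrahedron.
Variable T : tetrahedron.

Lemma corners_free : free T.
Proof. exact: basis_free (cornersP T). Qed.

Lemma corner_inj : injective (tnth T).
Proof. exact/tuple_uniqP/free_uniq/corners_free. Qed.

Lemma corner_neq0 c : c \in corners T -> c != 0%R.
Proof. exact: free_not0 corners_free. Qed.

Lemma tline_sub_tpoints l x : l \in tlines T -> x \in l -> x \in tpoints T.
Proof.
case/imset2P=> c1 c2 c1T; rewrite inE => /andP[c2T c12] ->.
rewrite !inE => /orP[/orP[]|] /eqP->; rewrite ?c1T ?c2T //.
by apply/orP; right; apply/imset2P; exists c1 c2; rewrite // inE c2T c12.
Qed.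

Lemma weight2_notin_corners x : weight T x = 2 -> x \notin corners T.
Proof. by rewrite /weight; case: ifP. Qed.

Lemma card_tline l : l \in tlines T -> #|l| = 3.
Proof.
case/imset2P=> c1 c2 c1T; rewrite inE => /andP[c2T c12] ->.
rewrite setUC cardsU1 cards2 c12 !inE negb_or.
(* The midpoint differs from each of the two corners by the other one, which is nonzero. *)
rewrite -[X in _ == X]addr0 (inj_eq (addrI c1)) (corner_neq0 c2T).
by rewrite -[X in _ == X]add0r (inj_eq (addIr c2)) (corner_neq0 c1T).
Qed.

(** Two of the three points are corners, and [weight] gives corners the value 1, so only [c1 + c2]
    can count. *)
Lemma weight2_tline l :
  l \in tlines T -> #|[set x in l | weight T x == 2]| <= 1.
Proof.
case/imset2P=> c1 c2 c1T; rewrite inE => /andP[c2T c12] ->.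
rewrite -[X in _ <= X](cards1 (c1 + c2)%R) subset_leq_card //; apply/subsetP => x.
rewrite !inE => /andP[xl /eqP/weight2_notin_corners xT].
by case/orP: xl => [/orP[]|] /eqP ex //; rewrite ex ?c1T ?c2T in xT.
Qed.

(* A line has three points, so the values on the three ends at [v] are pairwise
   distinct. *)
Lemma weight2_ends_at (L : finType) (M : multipole L) phi (v : vertex M) :
    cubic M -> tetrahedral_flow T phi ->
  #|[set h in ends_at v | weight T (phi h.1) == 2]| <= 1.
Proof.
move=> M_cubic [_ /(_ v) line_v].
have inj_phi : {in ends_at v &, injective (fun h => phi h.1)}.
  by apply/imset_injP; rewrite M_cubic card_tline.
apply: leq_trans (weight2_tline line_v).
rewrite -(card_in_imset (f := fun h => phi h.1)); last first.
  move=> h1 h2; rewrite !inE => /andP[h1v _] /andP[h2v _].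
  by apply: inj_phi; rewrite inE.
apply/subset_leq_card/subsetP => _ /imsetP[h /[!inE] /andP[hv h2] ->].
by rewrite h2 andbT; apply/imsetP; exists h; rewrite ?inE.
Qed.

End Tetrahedron.

Lemma sum_nat_bool (I : finType) (A P : pred I) :
  \sum_(i | A i) P i = #|[set i | A i && P i]|.
Proof.
by rewrite -sum1dep_card big_mkcondr; apply: eq_bigr => i _; case: (P i).
Qed.

(** * How four perfect matchings meet the three edge ends at a vertex *)

Section LocalStructure.
Variables (I : finType) (E : {set I}) (S : I -> {set 'I_4}).
Hypothesis card_E : #|E| = 3.
Hypothesis S_neq0 : forall h, h \in E -> S h != set0.
Hypothesis S_exact : forall k, #|[set h in E | k \in S h]| = 1.

(** Double counting of the pairs [(h, k)] with [k \in S h]: each of the four indices occurs exactly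
    once. *)
Let sum_card_S : \sum_(h in E) #|S h| = 4.
Proof.
rewrite (eq_bigr (fun h => \sum_k (k \in S h))); last first.
  by move=> h _; rewrite sum_nat_bool; apply: eq_card => k; rewrite inE.
rewrite exchange_big /= -[RHS]card_ord -sum1_card.
by apply: eq_bigr => k _; rewrite sum_nat_bool S_exact.
Qed.

Let disj_S h1 h2 k :
  h1 \in E -> h2 \in E -> k \in S h1 -> k \in S h2 -> h1 = h2.
Proof.
move=> E1 E2 k1 k2; have /eqP/cards1P[h0 Eh0] := S_exact k.
have h1E : h1 \in [set h in E | k \in S h] by rewrite inE E1.
have h2E : h2 \in [set h in E | k \in S h] by rewrite inE E2.
by move: h1E h2E; rewrite Eh0 !inE => /eqP-> /eqP->.
Qed.

Let cover_S k : exists2 h, h \in E & k \in S h.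
Proof.
have : 0 < #|[set h in E | k \in S h]| by rewrite S_exact.
by case/card_gt0P=> h /[!inE] /andP[]; exists h.
Qed.

(** Here [S h] stands for the indices of the matchings through the end [h]. These sets are three
    nonempty disjoint parts of four indices, so their sizes are 1, 1 and 2, and [c] is the end with
    the part of size 2. *)
Lemma exact_cover_of_triple : exists a b c i j,
  [/\ E = [set a; b; c], i != j,
      S a = [set i], S b = [set j] & S c = ~: [set i; j]].
Proof.
have [c cE c2] : exists2 c, c \in E & 1 < #|S c|.
  case: (boolP [exists h in E, 1 < #|S h|]) => [/exists_inP //|].
  rewrite negb_exists_in => /forall_inP small.
  (* This would read [4 <= 3]. *)
  suff : \sum_(h in E) #|S h| <= \sum_(h in E) 1.
    by rewrite sum_card_S sum1_card card_E.
  by apply: leq_sum => h /small; rewrite -leqNgt.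
have /eqP : #|E :\ c| = 2 by move: card_E; rewrite (cardsD1 c) cE => -[].
case/cards2P=> a [b [ab Eab]].
have defE : E = [set a; b; c] by rewrite -(setD1K cE) Eab setUC.
have aEc : a \in E :\ c by rewrite Eab !inE eqxx.
have bEc : b \in E :\ c by rewrite Eab !inE eqxx orbT.
have /andP[ac aE] : (a != c) && (a \in E) by rewrite -in_setD1.
have /andP[bc bE] : (b != c) && (b \in E) by rewrite -in_setD1.
have := sum_card_S; rewrite (big_setD1 c) //= Eab.
rewrite big_setU1 ?inE //= big_set1.
have := S_neq0 aE; have := S_neq0 bE; rewrite -!card_gt0 => Sb Sa sumS.
have split4 x y z : 1 < x -> 0 < y -> 0 < z -> x + (y + z) = 4 -> y = 1 /\ z = 1.
  by lia.
have [/eqP/cards1P[i Sai] /eqP/cards1P[j Sbj]] := split4 _ _ _ c2 Sa Sb sumS.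
have Scab k : k \in S c = (k \notin S a) && (k \notin S b).
  have [h hE kh] := cover_S k; apply/idP/idP => [kc|/andP[ka kb]].
    by apply/andP; split; apply/negP => kx;
       [move/eqP: ac | move/eqP: bc]; apply; apply: disj_S kx kc.
  by move: hE; rewrite defE !inE => /orP[/orP[]|] /eqP eh;
     move: kh ka kb; rewrite eh => ->.
exists a, b, c, i, j; split => //.
  apply: contra_neq ab => eij; apply: (@disj_S _ _ i) => //.
    by rewrite Sai inE.
  by rewrite Sbj eij inE.
by apply/setP => k; rewrite Scab Sai Sbj !inE negb_or.
Qed.

End LocalStructure.

(* At a vertex, four perfect matchings that cover all edges split as
   [{i}], [{j}], [{k, l}]; mapping [{i}] to [p_i] and [{k, l}] to the sum of
   the two complementary corners gives the line [p_i, p_j, p_i + p_j]. *)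
Lemma pm_coverable4_flow (T : tetrahedron) (H : graph) :
  cubic H -> pm_coverable H 4 -> exists phi, tetrahedral_flow (M := H) T phi.
Proof.
move=> H_cubic /existsP[t /andP[/allP t_pm /eqP t_cover]].
pose S (e : edge H) := [set i | e \in tnth t i].
pose val (U : {set 'I_4}) :=
  (\sum_(i in if #|U| == 1 then U else ~: U) tnth T i)%R.
have line v : [set val (S h.1) | h in ends_at v] \in tlines T.
  have S_neq0 h : h \in ends_at v -> S h.1 != set0.
    move=> _; have : h.1 \in \bigcup_(A <- t) A by rewrite t_cover inE.
    rewrite big_tuple => /bigcupP[i _ hi].
    by apply/set0Pn; exists i; rewrite inE.
  have S_exact k : #|[set h in ends_at v | k \in S h.1]| = 1.
    have /forallP/(_ v)/eqP := t_pm _ (mem_tnth k t).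
    by move=> card1; rewrite -[RHS]card1; apply: eq_card => h; rewrite !inE.
  have [a [b [c [i [j [-> ij Sa Sb Sc]]]]]] :=
    exact_cover_of_triple (H_cubic v) S_neq0 S_exact.
  rewrite !imsetU !imset_set1 Sa Sb Sc.
  have -> : val (~: [set i; j]) = (tnth T i + tnth T j)%R.
    (* The complement of a pair among four indices is again a pair, so [val] takes its second branch
       and sums over [i] and [j]. *)
    have cC : #|~: [set i; j]| == 1 = false.
      by have := cardsC [set i; j]; rewrite cards2 ij card_ord; lia.
    by rewrite /val cC setCK big_setU1 ?inE //= big_set1.
  rewrite /val !cards1 eqxx !big_set1.
  by apply/imset2P; exists (tnth T i) (tnth T j);
     rewrite ?inE ?mem_tnth //= (inj_eq (@corner_inj T)).
exists (fun e => val (S e)); split => // e.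
(* Some end of [e] is attached to a vertex, and the line there contains the value of [e]. *)
have [b [v ev]] := attachedP e.
apply: tline_sub_tpoints (line v) _.
by apply/imsetP; exists (e, b); rewrite // inE ev.
Qed.

(** The cover is padded with copies of its first matching, hence the hypothesis [0 < k]. *)
Lemma pm_coverable_leq (H : graph) k m :
  0 < k <= m -> pm_coverable H k -> pm_coverable H m.
Proof.
case: k => // k /= le_km /existsP[t /andP[/allP t_pm /eqP t_cover]].
have sz : size (t ++ nseq (m - k.+1) (thead t)) == m.
  by rewrite size_cat size_tuple size_nseq subnKC.
apply/existsP; exists (Tuple sz); rewrite /= all_cat all_nseq; apply/andP; split.
  apply/andP; split; first exact/allP.
  by rewrite t_pm ?orbT // mem_tnth.
by rewrite big_cat /= t_cover setTU.
Qed.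

(** * Free ends of a multipole, and counting the edge ends of a graph *)

Section FreeEnds.
Variables (L : finType) (M : multipole L).

Lemma free_end_exists (l : L) : exists h, endpoint (m := M) h == inr l.
Proof.
have /cards1P[h /setP/(_ h)] := free_end_uniq M l.
by rewrite !inE eqxx; exists h.
Qed.

Definition free_end l := xchoose (free_end_exists l).

Lemma endpoint_free_end l : endpoint (free_end l) = inr l.
Proof. exact/eqP/(xchooseP (free_end_exists l)). Qed.

Lemma free_endP h l : endpoint (m := M) h = inr l -> h = free_end l.
Proof.
move=> hl; have /cards1P[h0 /setP E] := free_end_uniq M l.
have := E h; have := E (free_end l).
by rewrite !inE endpoint_free_end hl eqxx => /esym/eqP-> /esym/eqP.
Qed.

End FreeEnds.

Arguments free_end {L M}.

Lemma graph_endpointP (G : graph) (h : edge G * bool) : {v | endpoint h = inl v}.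
Proof. by case: (endpoint h) => [v|[]]; exists v. Qed.

(** With no free ends, the sets [ends_at v] partition the edge ends, and a loop contributes twice on
    both sides. *)
Lemma sum_ends_at (G : graph) (F : edge G * bool -> nat) :
  \sum_v \sum_(h in ends_at v) F h = \sum_h F h.
Proof.
rewrite (partition_big (fun h => sval (graph_endpointP h)) predT) //=.
apply: eq_bigr => v _; apply: eq_bigl => h; rewrite inE.
by case: (graph_endpointP h) => w /= ->.
Qed.

Lemma card_edge_cubic (G : graph) : cubic G -> #|edge G| * 2 = #|vertex G| * 3.
Proof.
move=> G_cubic; rewrite -[in LHS]card_bool -card_prod -sum1_card -(@sum_ends_at G).
by rewrite -sum_nat_const; apply: eq_big => // v _; rewrite sum1_card G_cubic.
Qed.

(** * Edge ends of the superposition and the final count *)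

Section Superposition.
Variables (G : graph) (X : edge G -> pole22).

Definition pole_end e (h : edge (X e) * bool) : edge (superposition X) * bool :=
  (Tagged (fun e => edge (X e)) h.1, h.2).

(** What the [i]-th lift sees in place of the end [h]: the side [h.2] selects the connector of the
    pole, and [i] the dangling edge in it. *)
Definition lift_end (i : 'I_2) (h : edge G * bool) :
    edge (superposition X) * bool :=
  pole_end (free_end (M := X h.1) (h.2, i)).

Lemma pole_end_inj e : injective (@pole_end e).
Proof.
move=> [x b] [y c] [] /eqP; rewrite -tag_eqE /tag_eq eqxx /= tagged_asE.
by move=> /eqP-> ->.
Qed.

Lemma endpoint_lift_end i h v :
  endpoint h = inl v -> endpoint (lift_end i h) = inl (inl (v, i)).
Proof.
case: h => e s hv; rewrite /= /sup_endpoint /=.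
by rewrite -surjective_pairing endpoint_free_end hv.
Qed.

(** The tag recovers the edge of [G], and the name of the free end recovers the side. *)
Lemma lift_end_inj i : injective (lift_end i).
Proof.
move=> [e s] [e' s'] E; have ee' : e = e' by case: E => ->.
move: E; rewrite -{}ee' => /pole_end_inj /(congr1 (endpoint (m := _))).
by rewrite !endpoint_free_end => -[->].
Qed.

Lemma ends_at_pole e (x : vertex (X e)) :
  ends_at (inr (Tagged (fun e => vertex (X e)) x) : vertex (superposition X))
    = @pole_end e @: ends_at x.
Proof.
apply/setP => h; apply/idP/imsetP => [|[[y b] + ->]]; last first.
  by rewrite !inE /= /sup_endpoint /= => /eqP ->.
rewrite inE /= /sup_endpoint; case: h => -[e' y] b /=.
case E: (endpoint (y, b)) => [x'|[s i]].
  move=> /eqP xx'; have ee' : e' = e by case: xx'.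
  subst e'; exists (y, b) => //; rewrite inE E.
  by move: xx' => /eqP; rewrite !(inj_eq inl_inj, inj_eq inr_inj) eq_Tagged.
(* A free end of a pole gets attached to a lift, never to a pole vertex. *)
by case: (endpoint (e', s)) => // -[].
Qed.

Lemma ends_at_lift v i :
  ends_at (inl (v, i) : vertex (superposition X)) = lift_end i @: ends_at v.
Proof.
apply/setP => h; apply/idP/imsetP => [|[h' + ->]]; last first.
  by rewrite !inE => /eqP/endpoint_lift_end ->.
rewrite inE /= /sup_endpoint; case: h => -[e y] b /=.
case E: (endpoint (y, b)) => [//|[s j]].
case Es: (endpoint (e, s)) => [w|//] /eqP[wv ji]; exists (e, s).
  by rewrite inE Es wv.
by rewrite /lift_end /= -ji -(free_endP E).
Qed.

Hypothesis G_cubic : cubic G.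
Hypothesis X_cubic : forall e, cubic (X e).

Lemma cubic_superposition : cubic (superposition X).
Proof.
case=> [[v i]|[e x]].
  by rewrite ends_at_lift (card_imset _ (@lift_end_inj i)) G_cubic.
by rewrite ends_at_pole (card_imset _ (@pole_end_inj e)) X_cubic.
Qed.

Lemma flow_pole T (phi : edge (superposition X) -> _) e :
    tetrahedral_flow T phi ->
  tetrahedral_flow T
    (fun x : edge (X e) => phi (Tagged (fun e => edge (X e)) x)).
Proof.
case=> phi_pts phi_lines; split => [x|x]; first exact: phi_pts.
have := phi_lines (inr (Tagged (fun e => vertex (X e)) x)).
by rewrite ends_at_pole -imset_comp.
Qed.

Hypothesis G_nonempty : 0 < #|vertex G|.
Hypothesis X_heavy : forall e, heavy (X e).

Lemma superposition_flowN T (phi : edge (superposition X) -> _) :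
  ~ tetrahedral_flow T phi.
Proof.
move=> phi_flow; pose heavy_end h := weight T (phi (h : _ * bool).1) == 2.
have pole_bound e :
    2 <= \sum_(l : bool * 'I_2) heavy_end (lift_end l.2 (e, l.1)).
  apply: leq_trans (@X_heavy e T _ (@flow_pole T phi e phi_flow)) _.
  (* Every dangling edge of weight 2 carries a free end counted on the right, so these edges form a
     subset of the image of the counted names. *)
  rewrite sum_nat_bool; apply: leq_trans (leq_imset_card _ _).
  apply: subset_leq_card; apply/subsetP => x; rewrite inE => /andP[].
  case/existsP=> b /existsP[l /eqP/free_endP xl] x2; apply/imsetP.
  exists l; last exact: (congr1 fst xl).
  by rewrite inE /heavy_end /lift_end /= -surjective_pairing -xl.
have lift_bound v i : \sum_(h in ends_at v) heavy_end (lift_end i h) <= 1.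
  have :=
    weight2_ends_at (inl (v, i) : vertex (superposition X))
      cubic_superposition phi_flow.
  apply: leq_trans; rewrite ends_at_lift sum_nat_bool.
  rewrite -(card_imset _ (@lift_end_inj i)) subset_leq_card //.
  apply/subsetP => _ /imsetP[h /[!inE] /andP[hv h2] ->].
  by rewrite imset_f ?inE.
pose F i h : nat := heavy_end (lift_end i h).
(* The left side equals [#|vertex G| * 3], so this bound contradicts [G_nonempty]. *)
suff : #|edge G| * 2 <= #|vertex G| * 2.
  by rewrite (card_edge_cubic G_cubic); lia.
rewrite -!sum_nat_const.
apply: (@leq_trans (\sum_e \sum_(l : bool * 'I_2) F l.2 (e, l.1))).
  by apply: leq_sum => e _; apply: pole_bound.
(* The name [(s, i)] in the pole of [e] is regrouped as the lift index [i] and the end [(e, s)] of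
   [G]; for fixed [i] these ends are then sorted by vertex. *)
have -> : \sum_e \sum_(l : bool * 'I_2) F l.2 (e, l.1) =
    \sum_(i < 2) \sum_(h : edge G * bool) F i h.
  rewrite exchange_big.
  rewrite -(pair_big predT predT (fun s i => \sum_e F i (e, s))) /=.
  rewrite exchange_big; apply: eq_bigr => i _; rewrite exchange_big pair_big /=.
  by apply: eq_bigr => -[].
rewrite (eq_bigr _ (fun i _ => esym (sum_ends_at (F i)))) exchange_big.
apply: leq_sum => v _; rewrite -[X in _ <= X]card_ord -sum1_card.
by apply: leq_sum => i _; apply: lift_bound.
Qed.

Lemma superposition_has_edge : 0 < #|edge (superposition X)|.
Proof.
have : 0 < #|edge G| * 2 by rewrite card_edge_cubic // muln_gt0 G_nonempty.
rewrite muln_gt0 andbT => /card_gt0P[e _]; apply/card_gt0P.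
by exists (lift_end ord0 (e, false)).1.
Qed.

End Superposition.

Theorem theorem4p4 (G : graph) (X : edge G -> pole22)
    (G_nonempty : 0 < #|vertex G|)
    (G_cubic : cubic G)
    (X_cubic : forall e, cubic (X e))
    (X_heavy : forall e, heavy (X e)) :
  geq_oo (pm_index (superposition X)) 5 /\
  ~~ pm_coverable (superposition X) 4.
Proof.
have not4 : ~~ pm_coverable (superposition X) 4.
  apply/negP => cov4; have [T] := tetrahedron_inhabited.
  have [phi] := pm_coverable4_flow T (cubic_superposition G_cubic X_cubic) cov4.
  exact: superposition_flowN.
split=> //; rewrite /pm_index; case: pselect => //= ex_k.
(* A least [k] of at most 4 could be padded to a cover by exactly four matchings. *)
case: ex_minnP => k cov_k _; rewrite ltnNge; apply: contra not4 => le_k4.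
apply: (pm_coverable_leq _ cov_k); rewrite le_k4 andbT lt0n.
(* The padding needs [k] to be positive: the empty family covers no edge, but the superposition has
   one. *)
apply/negP => /eqP k0; move: cov_k; rewrite k0 => /existsP[t /andP[_]].
rewrite tuple0 big_nil eq_sym -cards_eq0 cardsT -leqn0 leqNgt.
by rewrite superposition_has_edge.
Qed.
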